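(* There exists a prime power $q_0$ such that for every prime power $q \geq q_0$ there is a subgraph $H'$ of $H_q$ with $V(H') = V(H_q)$ and $E(H') \subseteq E(H_q)$ such that $H'$ is $K_4$-free and every two-coloring of $E(H')$ contains a monochromatic triangle.
   Context: Let $q$ be a prime power and $PG(2,q^2)$ the projective plane over $\mathbb{F}_{q^2}$. The Hermitian unital is $\mathscr{U}_q = \{\langle X,Y,Z\rangle : X^{q+1}+Y^{q+1}+Z^{q+1}=0\}$, a set of points of $PG(2,q^2)$. Every line of $PG(2,q^2)$ meets $\mathscr{U}_q$ in exactly $1$ or exactly $q+1$ points; lines meeting it in $q+1$ points are called secants, and $\mathscr{L}_q$ denotes the set of secants. The graph $H_q$ has vertex set $\{v_\ell : \ell \in \mathscr{L}_q\}$, with $v_{\ell_1} \sim v_{\ell_2}$ iff $\ell_1 \neq \ell_2$ and $\ell_1 \cap \ell_2 \in \mathscr{U}_q$. *)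

(* Defs.v *)
From HB Require Import structures.
From mathcomp Require Import all_boot all_order all_algebra all_field.
Set Implicit Arguments. Unset Strict Implicit. Unset Printing Implicit Defensive.
Import GRing.Theory.
Local Open Scope ring_scope.

Definition prime_power (q : nat) : Prop :=
  exists p k : nat, [/\ prime p, (0 < k)%N & q = (p ^ k)%N].

Section Hermitian.
Variable F : finFieldType.

(* Homogeneous coordinates in F^3.  Each point (resp. line) of PG(2,F) has a
   unique normalized representative: first nonzero coordinate equal to 1. *)
Definition normalized (v : F * F * F) : bool :=
  [|| v.1.1 == 1,
      (v.1.1 == 0) && (v.1.2 == 1)
    | [&& v.1.1 == 0, v.1.2 == 0 & v.2 == 1]].

Definition incident (l p : F * F * F) : bool :=
  l.1.1 * p.1.1 + l.1.2 * p.1.2 + l.2 * p.2 == 0.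

(* Hermitian unital U_q: X^(q+1) + Y^(q+1) + Z^(q+1) = 0 (with |F| = q^2). *)
Definition unital (q : nat) (p : F * F * F) : bool :=
  p.1.1 ^+ q.+1 + p.1.2 ^+ q.+1 + p.2 ^+ q.+1 == 0.

Definition secant (q : nat) (l : F * F * F) : bool :=
  normalized l &&
  (#|[set p : F * F * F | [&& normalized p, incident l p & unital q p]]| == q.+1)%N.

Definition Hadj (q : nat) : rel (F * F * F) := fun l1 l2 =>
  [&& secant q l1, secant q l2, l1 != l2 &
      [exists p : F * F * F,
         [&& normalized p, incident l1 p, incident l2 p & unital q p]]].
End Hermitian.

Definition K4free (T : finType) (E : rel T) : Prop :=
  ~ exists a b c d : T,
      uniq [:: a; b; c; d] /\
      [&& E a b, E a c, E a d, E b c, E b d & E c d].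

Definition edge2col_mono_triangle (T : finType) (E : rel T) : Prop :=
  forall col : {set T} -> bool,
    exists x y z : T,
      [/\ uniq [:: x; y; z], E x y, E y z & E x z] /\
      col [set x; y] = col [set y; z] /\ col [set x; y] = col [set x; z].

(* Main.v *)
Require Import Defs.
From HB Require Import structures.
From mathcomp Require Import all_boot all_order all_algebra all_field.
From mathcomp Require Import zify ring lra.
Set Implicit Arguments. Unset Strict Implicit. Unset Printing Implicit Defensive.
Import Order.TTheory GRing.Theory Num.Theory.
Local Open Scope ring_scope.

(** Attach an independent random sign w x l to every flag (point x of the unital on a
    secant l) and keep an edge of [H_q] only when its two secants have opposite signs at
    their common point.  The unital contains no O'Nan configuration, so three of the four
    secants of a K4 are concurrent, and these would need pairwise distinct signs: the
    subgraph is K4-free.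

    In a colouring without monochromatic triangle, every triangle has two bichromatic
    corners and one monochromatic one, so weighting them by 1 and -2 gives total weight 0.
    Grouped by the corner l and by the point x off l where the opposite edge lies, 4 times
    the weight is - n^2 - 3 C^2 + S^2 + 3 T^2, where n counts the neighbours of l through x
    and C, S, T are the sums over them of colours, signs and products of both.  The sum of
    n^2 over x is of order q^5, whereas with positive probability the sum of the squared
    sign sums is at most a small multiple of q^5, simultaneously for all l and all subsets
    of the secants meeting l: the second moment makes a large sign sum at one point
    unlikely by a factor of order 1/q, and independence over about q^3 points beats the
    2^O(q^3) subsets. *)

(** * Random signs *)

Definition signed_sum (Y : finType) (f : {ffun Y -> bool}) (A : {set Y}) : int :=
  \sum_(l in A) (-1) ^+ f l.

Lemma sum_sign_pair (Y : finType) (l m : Y) : l != m ->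
  \sum_(f : {ffun Y -> bool}) ((-1) ^+ f l * (-1) ^+ f m : int) = 0.
Proof.
move=> lm; pose flip (f : {ffun Y -> bool}) := [ffun i => f i (+) (i == l)].
have flipK : involutive flip by move=> f; apply/ffunP=> i; rewrite !ffunE addbK.
set s := LHS; suff: s = - s by lia.
rewrite {1}/s (reindex_inj (inv_inj flipK)) -sumrN; apply: eq_bigr => f _ /=.
by rewrite !ffunE eqxx eq_sym (negPf lm) addbF addbT signrN mulNr.
Qed.

(** Signs at distinct elements are uncorrelated, so after expanding the square only the diagonal
    terms survive. *)
Lemma second_moment (Y : finType) (A : {set Y}) :
  \sum_(f : {ffun Y -> bool}) signed_sum f A ^+ 2 = (2 ^ #|Y| * #|A|)%:R.
Proof.
under eq_bigr do rewrite expr2 big_distrlr /=.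
rewrite exchange_big /= (eq_bigr (fun=> (2 ^ #|Y|)%:R)).
  by rewrite sumr_const natrM mulr_natr.
move=> l lA; rewrite exchange_big /= (bigD1 l) //= [X in _ + X]big1.
  under eq_bigr do rewrite -expr2 sqrr_sign.
  by rewrite addr0 sumr_const cardT -cardE card_ffun card_bool.
by move=> m /andP[_ ml]; apply: sum_sign_pair; rewrite eq_sym.
Qed.

Lemma signed_sum_le (Y : finType) (f : {ffun Y -> bool}) (A : {set Y}) :
  (`|signed_sum f A| <= #|A|)%N.
Proof.
suff: `|signed_sum f A| <= #|A|%:R by lia.
apply: le_trans (ler_norm_sum _ _ _) _.
by under eq_bigr do rewrite normr_sign; rewrite sumr_const.
Qed.

Lemma second_moment_nat (Y : finType) (A : {set Y}) :
  (\sum_(f : {ffun Y -> bool}) `|signed_sum f A| ^ 2 = 2 ^ #|Y| * #|A|)%N.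
Proof.
apply/eqP; rewrite -(eqr_nat int) -second_moment natr_sum; apply/eqP.
by apply: eq_bigr => f _; rewrite natrX natz abszE real_normK ?num_real.
Qed.

Lemma markov_card (I : finType) (X : I -> nat) (t : nat) :
  (t * #|[set i | t <= X i]| <= \sum_i X i)%N.
Proof.
rewrite mulnC -sum_nat_const [leqRHS](bigID (fun i => t <= X i)%N) /=.
apply: leq_trans (leq_addr _ _); under eq_bigl do rewrite inE.
exact: leq_sum.
Qed.

(** This bound on the signed sum guarantees that each sign occurs on at least a quarter of [A]. *)
Definition balanced (Y : finType) (A : {set Y}) : {set {ffun Y -> bool}} :=
  [set f | 2 * `|signed_sum f A| <= #|A|]%N.

(** Chebyshev: an unbalanced [f] has squared sum above [#|A| ^ 2 / 4], while the mean square is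
    [#|A|]. Hence a proportion below [4 / #|A|], at most one half, is unbalanced. *)
Lemma card_balanced (Y : finType) (A : {set Y}) : (8 <= #|A|)%N ->
  (2 ^ #|Y| <= 2 * #|balanced A|)%N.
Proof.
move=> A8; have := markov_card (fun f => `|signed_sum f A| ^ 2)%N (#|A| ^ 2 %/ 4).+1.
rewrite second_moment_nat; set B := [set i | _] => le_moment.
have : (#|{ffun Y -> bool}| <= #|balanced A| + #|B|)%N.
  rewrite -cardsT; apply: leq_trans (leq_card_setU _ _); apply/subset_leq_card/subsetP=> f _.
  rewrite !inE; case: (leqP _ (`|_| ^ 2)) => lt_f; rewrite ?orbT ?orbF //.
  rewrite -(@leq_pmul2l 4) //; nia.
rewrite card_ffun card_bool; nia.
Qed.

Definition energy (X Y : finType) (w : {ffun X -> {ffun Y -> bool}})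
    (P : {set X}) (a : X -> {set Y}) : nat :=
  (\sum_(x in P) `|signed_sum (w x) (a x)| ^ 2)%N.

(** If every [a x] has at most [k] elements, the energy is trivially at most [k ^ 2 * #|P|]. Heavy
    means exceeding the fraction [2 / D] of this trivial bound. *)
Definition heavy (X Y : finType) (D k : nat) (P : {set X}) (a : X -> {set Y})
  : {set {ffun X -> {ffun Y -> bool}}} :=
  [set w | 2 * k ^ 2 * #|P| < D * energy w P a]%N.

(** An exponential-moment argument: a product of independent weights has small mean, yet is huge on
    every heavy [w]. The probability of being heavy is at most [2 ^ #|P| / 2 ^ (c * #|P|)]. *)
Lemma card_heavy (X Y : finType) (c D k : nat) (P : {set X}) (a : X -> {set Y}) :
    (0 < k)%N -> (D * 2 ^ (c * D) <= k)%N -> (forall x, x \in P -> #|a x| <= k)%N ->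
  (#|heavy D k P a| * 2 ^ (c * #|P|) <= 2 ^ #|P| * #|{ffun X -> {ffun Y -> bool}}|)%N.
Proof.
move=> k0 Dk ak.
have cardF : #|[eta xpredT] : pred {ffun Y -> bool}| = (2 ^ #|Y|)%N.
  by rewrite -card_bool -card_ffun; apply: eq_card.
(* The summand [k] keeps each factor over [P] at least [k]. By the second moment its mean is
   [k + #|a x|], at most [2 * k]. *)
pose wt x f := (if x \in P then k + `|signed_sum f (a x)| ^ 2 else 1)%N.
have le_weight : (\sum_w \prod_x wt x ((w : {ffun X -> {ffun Y -> bool}}) x)
    <= (2 * k) ^ #|P| * #|{ffun X -> {ffun Y -> bool}}|)%N.
  rewrite -bigA_distr_bigA card_ffun -prod_nat_const -[in leqRHS]prod_nat_const.
  rewrite [X in (X * _)%N]big_mkcond -big_split /=; apply: leq_prod => x _.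
  rewrite /wt card_ffun card_bool; case: ifP => xP; last by rewrite sum_nat_const cardF mul1n muln1.
  rewrite big_split /= sum_nat_const second_moment_nat cardF.
  by rewrite -mulnDr mulnC leq_mul2r mul2n -addnn leq_add2l ak ?orbT.
have ge_weight w : w \in heavy D k P a ->
    (k ^ #|P| * 2 ^ (c * #|P|) <= \prod_x wt x (w x))%N.
  rewrite inE /energy => hw.
  pose bad := [set x in P | k ^ 2 <= D * `|signed_sum (w x) (a x)| ^ 2]%N.
  (* In [D * energy] a bad point contributes at most [D * k ^ 2] and any other less than [k ^ 2].
     Heaviness therefore forces at least one point in [D] to be bad. *)
  have Pbad : (#|P| <= D * #|bad|)%N.
    rewrite -(@leq_pmul2l (k ^ 2)) ?expn_gt0 ?k0 //.
    move: hw; set e := (\sum_(x in P) _)%N => hw.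
    suff le_e : (D * e <= D * k ^ 2 * #|bad| + k ^ 2 * #|P|)%N.
      by have := leq_trans hw le_e; move: (k ^ 2)%N #|P| #|bad| => K p b; lia.
    rewrite /e.
    have -> : (D * k ^ 2 * #|bad| = \sum_(x in P) if x \in bad then D * k ^ 2 else 0)%N.
      rewrite -big_mkcondr /= mulnC -sum_nat_const; apply: eq_bigl => x.
      by rewrite inE; case: (x \in P).
    rewrite [(k ^ 2 * _)%N]mulnC -sum_nat_const -big_split big_distrr /=.
    apply: leq_sum => x xP; rewrite inE xP /=; case: (leqP (k ^ 2)) => [_|/ltnW //].
    by rewrite (leq_trans _ (leq_addr _ _)) // leq_mul2l leq_exp2r //
       (leq_trans (signed_sum_le _ _)) ?ak ?orbT.
  have le1 : (2 ^ (c * #|P|) <= \prod_(x in bad) 2 ^ (c * D))%N.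
    by rewrite prod_nat_const -expnM leq_exp2l // -mulnA leq_mul2l Pbad orbT.
  apply: (leq_trans (leq_mul (leqnn _) le1)).
  rewrite -prod_nat_const big_mkcond [X in (_ * X)%N]big_mkcond -big_split /=.
  apply: leq_prod => x _; rewrite /wt inE; case: ifP => //= xP; case: ifP => [bx|_]; last by lia.
  have D0 : (0 < D)%N by case: (D) bx => //; nia.
  (* At a bad point, [D * 2 ^ (c * D) * k <= k ^ 2], which is at most [D] times the squared sum. *)
  rewrite -(@leq_pmul2l D) //; nia.
have {}ge_weight : (#|heavy D k P a| * (k ^ #|P| * 2 ^ (c * #|P|)) <=
    (2 * k) ^ #|P| * #|{ffun X -> {ffun Y -> bool}}|)%N.
  rewrite -sum_nat_const; apply: leq_trans le_weight; 
  apply: (@leq_trans (\sum_(w in heavy D k P a) \prod_x wt x (w x))).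
    exact: leq_sum.
  by rewrite [leqRHS](bigID (fun w => w \in heavy D k P a)) /= leq_addr.
move: ge_weight; rewrite expnMn => H; rewrite -(@leq_pmul2l (k ^ #|P|)) ?expn_gt0 ?k0 //; nia.
Qed.

(** A union bound inside an unlikely event. Balance at all points has probability at least
    [2 ^ - #|X|], hence at least [2 ^ - (2 * N)]. Each heavy event has probability at most
    [2 ^ N / 2 ^ (c * N)], so together the [#|J|] of them cannot cover the balanced assignments. *)
Lemma exists_light_signs (X Y I : finType) (c D k N : nat) (J : {set I})
    (P : I -> {set X}) (a : I -> X -> {set Y}) (B : X -> {set Y}) :
    (0 < k)%N -> (D * 2 ^ (c * D) <= k)%N ->
    (forall i, i \in J -> #|P i| = N) ->
    (forall i x, i \in J -> x \in P i -> #|a i x| <= k)%N ->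
    (forall x, 8 <= #|B x|)%N -> (#|X| <= 2 * N)%N -> (#|J| * 2 ^ (3 * N) < 2 ^ (c * N))%N ->
  exists w : {ffun X -> {ffun Y -> bool}},
    (forall x, w x \in balanced (B x)) /\
    (forall i, i \in J -> w \notin heavy D k (P i) (a i)).
Proof.
move=> k0 Dk PN ak B8 XN J_lt.
pose Bal := [set w : {ffun X -> {ffun Y -> bool}} | [forall x, w x \in balanced (B x)]].
have le_Bal : (#|{ffun X -> {ffun Y -> bool}}| <= 2 ^ #|X| * #|Bal|)%N.
  have -> : #|Bal| = (\prod_x #|balanced (B x)|)%N.
    rewrite cardsE -(eq_card (A := family (fun x => balanced (B x)))) //.
    by rewrite card_family foldrE big_map big_enum.
  rewrite !card_ffun card_bool -[leqLHS]prod_nat_const -[X in (X * _)%N]prod_nat_const -big_split /=.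
  by apply: leq_prod => x _; apply: card_balanced.
have Om0 : (0 < #|{ffun X -> {ffun Y -> bool}}|)%N by rewrite !card_ffun card_bool !expn_gt0.
case: (boolP [exists w, (w \in Bal) && [forall (i | i \in J), w \notin heavy D k (P i) (a i)]]).
  case/existsP=> w /andP[]; rewrite inE => /forallP wB /forallP wJ.
  by exists w; split=> // i iJ; have := wJ i; rewrite iJ.
rewrite negb_exists => /forallP no_w.
have sub : Bal \subset \bigcup_(i in J) heavy D k (P i) (a i).
  apply/subsetP=> w wB; have := no_w w; rewrite wB /= => /forallPn[i].
  by rewrite negb_imply negbK => /andP[iJ wi]; apply/bigcupP; exists i.
have le1 : (#|Bal| * 2 ^ (c * N) <= #|J| * (2 ^ N * #|{ffun X -> {ffun Y -> bool}}|))%N.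
  apply: (@leq_trans ((\sum_(i in J) #|heavy D k (P i) (a i)|) * 2 ^ (c * N))).
    rewrite leq_mul2r; apply/orP; right; apply: leq_trans (subset_leq_card sub) _.
    apply: (big_ind2 (fun (A : {set _}) n => #|A| <= n)%N) => //; first by rewrite cards0.
    by move=> A m A' n Am An; apply: leq_trans (leq_card_setU _ _) (leq_add Am An).
  rewrite big_distrl -sum_nat_const /=; apply: leq_sum => i iJ.
  by rewrite -(PN i iJ); apply: card_heavy => // x; apply: ak.
have le2 : (2 ^ N * 2 ^ #|X| <= 2 ^ (3 * N))%N.
  by rewrite -expnD leq_exp2l // mulSn leq_add2l.
move: le_Bal Om0 le1 le2 J_lt; move: #|{ffun _ -> _}| #|Bal| #|J| => om b j.
move: (2 ^ N)%N (2 ^ (c * N))%N (2 ^ (3 * N))%N (2 ^ #|X|)%N => n cn n3 x h1 h2 h3 h4 h5.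
have b0 : (0 < b)%N by case: b h1 {h3} => //; rewrite muln0; lia.
suff : (b * cn <= b * (j * n3))%N by rewrite leq_pmul2l //; lia.
apply: (leq_trans h3); rewrite [leqRHS]mulnCA leq_mul2l; apply/orP; right.
apply: (@leq_trans (n * (x * b))); first by rewrite leq_mul2l h1 orbT.
by rewrite mulnA mulnC leq_mul2l h4 orbT.
Qed.

(** * Arrowing in unitals without O'Nan configurations *)

Lemma big_setIdE (R : Type) (idx : R) (op : R -> R -> R) (T : finType) (A : {set T})
    (P : pred T) (F : T -> R) :
  \big[op/idx]_(x in [set x in A | P x]) F x = \big[op/idx]_(x in A | P x) F x.
Proof. by apply: eq_bigl => x; rewrite inE. Qed.

Lemma double_count (S T : finType) (A : {set S}) (B : {set T}) (R : S -> T -> bool) :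
  (\sum_(x in A) #|[set y in B | R x y]| = \sum_(y in B) #|[set x in A | R x y]|)%N.
Proof.
under eq_bigr => x _ do rewrite -sum1_card big_setIdE big_mkcondr.
rewrite exchange_big /=; apply: eq_bigr => y _.
by rewrite -sum1_card big_setIdE big_mkcondr.
Qed.

Lemma balanced_class (Y : finType) (f : {ffun Y -> bool}) (A : {set Y}) (b : bool) :
  f \in balanced A -> (#|A| <= 4 * #|[set m in A | f m != b]|)%N.
Proof.
rewrite inE /signed_sum => fA.
have sumE : \sum_(l in A) (-1) ^+ f l =
    (-1) ^+ b * (#|A|%:R - 2 * #|[set m in A | f m != b]|%:R) :> int.
  rewrite -!sumr_const big_setIdE /= big_mkcondr !big_distrr -sumrB big_distrr /=.
  by apply: eq_bigr => l _; case: (f l); case: b.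
by move: fA; rewrite sumE abszMsign; lia.
Qed.

(* Over the three apexes of a triangle that is not monochromatic the weights add up to
   -2 + 1 + 1 = 0. *)
Definition apex_weight (b c : bool) : int := if b == c then - 2 else 1.

(** The bound is stated through the signed sums of the two colour classes, because these are sums
    over sets of blocks, which is what lightness controls. *)
Lemma sum_apex_weight (Y : finType) (f : {ffun Y -> bool}) (A : {set Y}) (c : Y -> bool) :
  4 * \sum_(m in A) \sum_(n in A) (f m != f n)%:R * apex_weight (c m) (c n) <=
  - #|A|%:R ^+ 2 + 6 * signed_sum f [set m in A | c m] ^+ 2
                 + 6 * signed_sum f [set m in A | ~~ c m] ^+ 2.
Proof.
pose s m : int := (-1) ^+ f m; pose t m : int := (-1) ^+ c m.
(* Termwise, with primes for [n], the indicator is [(1 - s s') / 2] and the weight is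
   [(- 1 - 3 t t') / 2]; their product times 4 expands into the four squares. *)
have -> : 4 * \sum_(m in A) \sum_(n in A) (f m != f n)%:R * apex_weight (c m) (c n) =
    - (\sum_(m in A) 1) * (\sum_(m in A) 1) - 3 * (\sum_(m in A) t m) * (\sum_(m in A) t m)
    + (\sum_(m in A) s m) * (\sum_(m in A) s m)
    + 3 * (\sum_(m in A) s m * t m) * (\sum_(m in A) s m * t m).
  rewrite -!mulrA !mulNr !big_distrlr /= !big_distrr -!sumrN -!big_split /=.
  apply: eq_bigr => m _; rewrite !big_distrr -!sumrN -!big_split /=.
  apply: eq_bigr => n _; rewrite /s /t /apex_weight.
  by case: (f m); case: (f n); case: (c m); case: (c n).
have sE : \sum_(m in A) s m = signed_sum f [set m in A | c m] + signed_sum f [set m in A | ~~ c m].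
  by rewrite (bigID c) /= /signed_sum !big_setIdE.
have stE : \sum_(m in A) s m * t m =
    signed_sum f [set m in A | ~~ c m] - signed_sum f [set m in A | c m].
  rewrite (bigID c) /= addrC /signed_sum !big_setIdE -sumrN; congr (_ + _).
    by apply: eq_bigr => m /andP[_ /negPf cm]; rewrite /t cm mulr1.
  by apply: eq_bigr => m /andP[_ cm]; rewrite /t cm mulrN1.
rewrite sE stE sumr_const; move: (signed_sum _ _) (signed_sum _ _) (\sum_(m in A) t m) => a b u.
(* The identity used is [(a + b)^2 + 3 (b - a)^2 = 6 a^2 + 6 b^2 - 2 (a + b)^2]; the term [- 3 u^2]
   is dropped by its sign. *)
have := sqr_ge0 u; have := sqr_ge0 (a + b); nra.
Qed.

(** * Counting in a design with [q ^ 3 + 1] points, blocks of size [q + 1] and one block through any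
    two points *)

Section Unital.
Variables (X Y : finType) (inc : X -> Y -> bool) (q : nat).

Definition points_on l := [set x | inc x l].
Definition blocks_through x := [set l | inc x l].
Definition meeting l := [set m | (m != l) && [exists x, inc x l && inc x m]].

Hypothesis card_points_on : forall l, #|points_on l| = q.+1.
Hypothesis joined : forall x y, x != y -> exists l, inc x l && inc y l.
Hypothesis joined_unique :
  forall x y l m, x != y -> inc x l -> inc y l -> inc x m -> inc y m -> l = m.
Hypothesis card_points : #|X| = (q ^ 3 + 1)%N.
Hypothesis q_gt0 : (0 < q)%N.

Lemma meet_unique l m x y :
  l != m -> inc x l -> inc x m -> inc y l -> inc y m -> x = y.
Proof.
move=> lm xl xm yl ym; apply: contra_neq_eq lm => xy.
exact: (joined_unique xy).
Qed.

Lemma meetingP l m x : m != l -> inc x l -> inc x m -> m \in meeting l.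
Proof. by move=> ml xl xm; rewrite inE ml; apply/existsP; exists x; rewrite xl. Qed.

(** The blocks through [x] partition the other [q ^ 3] points into classes of size [q]. *)
Lemma card_blocks_through x : #|blocks_through x| = (q ^ 2)%N.
Proof.
have := double_count (blocks_through x) [set~ x] (fun l y => inc y l).
rewrite (eq_bigr (fun=> q)); last first.
  move=> l; rewrite inE => xl; apply/eqP; rewrite -eqSS -(card_points_on l).
  rewrite (cardsD1 x (points_on l)) inE xl add1n eqSS; apply/eqP/eq_card => y.
  by rewrite !inE.
rewrite [RHS](eq_bigr (fun=> 1%N)) => [|y]; last first.
  rewrite !inE => yx; have [l /andP[yl xl]] := joined yx.
  apply/eqP/cards1P; exists l; apply/setP=> m; rewrite !inE; apply/andP/eqP.
    by case=> xm ym; apply: (joined_unique yx).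
  by move->.
rewrite !sum_nat_const cardsC1 card_points; nia.
Qed.

Definition off l := ~: points_on l.

Lemma card_off l : #|off l| = (q ^ 3 - q)%N.
Proof. by rewrite cardsCs setCK card_points card_points_on; lia. Qed.

(** A block through [x] that meets [l] is determined by the point of [l] it contains. *)
Lemma card_meeting_through l x :
  x \in off l -> (#|meeting l :&: blocks_through x| <= q.+1)%N.
Proof.
rewrite !inE => xl; set A := _ :&: _.
have := double_count A (points_on l) (fun m y => inc y m); set lhs := LHS => eq_lhs.
have : (lhs <= \sum_(y in points_on l) 1)%N.
  rewrite eq_lhs; apply: leq_sum => y; rewrite inE => yl; apply/card_le1P => m.
  rewrite !inE -!andbA => /and4P[ml me xm ym] n; rewrite !inE -!andbA.
  apply/and4P/eqP => [[_ _ xn yn]|->]; last by split.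
    by apply: (joined_unique (x := x) (y := y)) => //; apply: contraNneq xl => ->.
rewrite sum1_card card_points_on; apply: leq_trans; rewrite -sum1_card.
apply: leq_sum => m; rewrite !inE => /andP[/andP[_ /existsP[y /andP[yl ym]]] _].
by apply/card_gt0P; exists y; rewrite !inE yl.
Qed.

Lemma card_meeting_off l m : m \in meeting l -> #|[set x in off l | inc x m]| = q.
Proof.
rewrite inE => /andP[ml /existsP[y /andP[yl ym]]].
apply/eqP; rewrite -eqSS -(card_points_on m) (cardsD1 y (points_on m)) inE ym add1n eqSS.
apply/eqP/eq_card => x; rewrite !inE; case: (boolP (inc x m)) => xm; rewrite ?andbF ?andbT //.
congr (~~ _).
by apply/idP/eqP => [xl|->//]; apply: (meet_unique ml).
Qed.

Lemma sum_meeting_off l (A : {set Y}) : A \subset meeting l ->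
  (\sum_(x in off l) #|A :&: blocks_through x| = q * #|A|)%N.
Proof.
move=> /subsetP Al; have := double_count A (off l) (fun m y => inc y m).
rewrite (eq_bigr (fun=> q)) => [|m /Al]; last exact: card_meeting_off.
rewrite sum_nat_const mulnC => ->; apply: eq_bigr => x _.
by apply: eq_card => m; rewrite !inE.
Qed.

(** Stated as twice [#|off l|], so that the number of subsets of [meeting l] is comparable with the
    failure probability of a single heavy event. *)
Lemma card_meeting l : (#|meeting l| <= 2 * (q ^ 3 - q))%N.
Proof.
have : (q * #|meeting l| <= q.+1 * (q ^ 3 - q))%N.
  rewrite -(sum_meeting_off (subxx _)) -(card_off l) mulnC -sum_nat_const.
  exact: leq_sum (@card_meeting_through l).
have := q_gt0; nia.
Qed.

Lemma card_blocks : (#|Y| <= (q ^ 3 + 1) * q ^ 2)%N.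
Proof.
have := double_count [set: X] [set: Y] inc.
rewrite (eq_bigr (fun=> q ^ 2)%N) => [|x _]; last first.
  by rewrite -(card_blocks_through x); apply: eq_card => l; rewrite !inE.
rewrite [RHS](eq_bigr (fun=> q.+1)) => [|l _]; last first.
  by rewrite -(card_points_on l); apply: eq_card => x; rewrite !inE.
by rewrite !sum_nat_const !cardsT card_points => ->; rewrite leq_pmulr.
Qed.

(** * The signed subgraph and its neighbourhoods *)

Definition signed_adj (w : {ffun X -> {ffun Y -> bool}}) : rel Y := fun l m =>
  (l != m) && [exists x, [&& inc x l, inc x m & w x l != w x m]].

Variable w : {ffun X -> {ffun Y -> bool}}.

Lemma signed_adj_sym : symmetric (signed_adj w).
Proof.
move=> l m; rewrite /signed_adj eq_sym; congr (_ && _); apply: eq_existsb => x.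
by rewrite andbCA eq_sym.
Qed.

Lemma signed_adjP l m : reflect
  (l != m /\ exists x, [/\ inc x l, inc x m & w x l != w x m]) (signed_adj w l m).
Proof.
apply: (iffP andP) => -[lm ex]; split=> //.
  by case/existsP: ex => x /and3P[]; exists x.
by case: ex => x [xl xm wx]; apply/existsP; exists x; rewrite xl xm.
Qed.

(* Around a point the graph is bipartite, hence triangle-free. *)
Lemma signed_adj_no_concurrent l m n x :
  signed_adj w l m -> signed_adj w m n -> signed_adj w l n ->
  inc x l -> inc x m -> inc x n -> False.
Proof.
move=> /signed_adjP[lm [y [yl ym wy]]] /signed_adjP[mn [z [zm zn wz]]].
move=> /signed_adjP[ln [t [tl tn wt]]] xl xm xn; move: wy wz wt.
rewrite (meet_unique lm yl ym xl xm) (meet_unique mn zm zn xm xn).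
by rewrite (meet_unique ln tl tn xl xn); case: (w x l); case: (w x m); case: (w x n).
Qed.

Definition nbrs l := [set m | signed_adj w l m].

Lemma nbrs_sub_meeting l : nbrs l \subset meeting l.
Proof.
apply/subsetP => m; rewrite inE => /signed_adjP[lm [x [xl xm _]]].
by apply: meetingP xl xm; rewrite eq_sym.
Qed.

(** At each of the [q + 1] points of [l], balance yields at least [q ^ 2 / 4] blocks of opposite
    sign. No neighbour is counted twice, since it meets [l] only once. *)
Lemma card_nbrs l : (forall x, w x \in balanced (blocks_through x)) ->
  (q.+1 * q ^ 2 <= 4 * #|nbrs l|)%N.
Proof.
move=> bal; have := double_count (nbrs l) (points_on l) (fun m y => inc y m).
set lhs := LHS => eq_lhs; have le_lhs : (lhs <= #|nbrs l|)%N.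
  rewrite -sum1_card; apply: leq_sum => m.
  move=> /(subsetP (nbrs_sub_meeting l)); rewrite inE => /andP[ml _].
  apply/card_le1P => y; rewrite !inE => /andP[yl ym] x; rewrite !inE.
  apply/andP/eqP => [[xl xm]|->//]; exact: (meet_unique ml).
suff : (q.+1 * q ^ 2 <= 4 * lhs)%N by move/leq_trans; apply; rewrite leq_mul2l le_lhs.
rewrite eq_lhs -(card_points_on l) -sum_nat_const big_distrr /=; apply: leq_sum => x.
rewrite inE => xl; rewrite -(card_blocks_through x).
apply: leq_trans (balanced_class (w x l) (bal x)) _.
rewrite leq_mul2l /=; apply/subset_leq_card/subsetP => m; rewrite !inE.
case/andP=> xm wxm; rewrite xm andbT; apply/signed_adjP; split.
  by apply: contraNneq wxm => ->.
by exists x; rewrite eq_sym.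
Qed.

(** Convexity: the [q * #|nbrs l|] incidences are spread over fewer than [q ^ 3] points, so on
    average at least about [q / 4] neighbours pass through a point off [l]. *)
Lemma sum_sq_nbrs l : (forall x, w x \in balanced (blocks_through x)) ->
  (q ^ 5 <= 16 * \sum_(x in off l) #|nbrs l :&: blocks_through x| ^ 2)%N.
Proof.
move=> bal; have := sum_meeting_off (nbrs_sub_meeting l); have := card_nbrs l bal.
set n := fun x => #|nbrs l :&: blocks_through x|; rewrite -/(\sum_(x in off l) n x)%N => cN sN.
have : (8 * q * \sum_(x in off l) n x <=
        16 * (\sum_(x in off l) n x ^ 2) + #|off l| * q ^ 2)%N.
  rewrite !big_distrr -sum_nat_const -big_split /=; apply: leq_sum => x _.
  (* The tangent to the square at [q / 4] replaces Cauchy-Schwarz: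
     [2 * (4 n) * q <= (4 n)^2 + q^2]. *)
  by have [le_sq _] := nat_Cauchy (4 * n x) q; move: le_sq; rewrite expnMn; lia.
rewrite sN card_off -/(\sum_(x in off l) n x ^ 2)%N.
have le_off : ((q ^ 3 - q) * q ^ 2 <= q ^ 5)%N.
  by rewrite (expnD q 3 2) leq_mul2r leq_subr orbT.
move: cN le_off (\sum_(x in off l) _)%N => cN le_off s.
have : (2 * q ^ 2 * (q.+1 * q ^ 2) <= 2 * q ^ 2 * (4 * #|nbrs l|))%N.
  by rewrite leq_mul2l cN orbT.
move: #|nbrs l| ((q ^ 3 - q) * q ^ 2)%N le_off => N d; nia.
Qed.

(** Localizes the edge opposite to the apex [l] at a point. That point lies off [l], for otherwise
    [l], [m], [n] would be a concurrent triangle; for [m = n] every summand vanishes. *)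
Lemma signed_adj_in_nbrs l m n : m \in nbrs l -> n \in nbrs l ->
  ((signed_adj w m n)%:R : int) =
  \sum_(x in off l | inc x m && inc x n) (w x m != w x n)%:R.
Proof.
rewrite !inE => lm ln; case: (boolP (signed_adj w m n)) => [mn|not_mn].
  have /signed_adjP[neq_mn [x [xm xn wx]]] := mn.
  have xoff : x \in off l.
    by rewrite !inE; apply/negP => xl; apply: (signed_adj_no_concurrent lm mn ln xl xm xn).
  rewrite (bigD1 x) ?xoff ?xm //= wx big1 ?addr0 // => y /andP[/andP[_ /andP[ym yn]] /eqP[]].
  exact: (meet_unique neq_mn).
rewrite big1 // => x /andP[_ /andP[xm xn]]; case: eqP => //= /eqP wx.
case/negP: not_mn; apply/signed_adjP; split; last by exists x.
by apply: contraNneq wx => ->.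
Qed.

Definition apex_sum (c : Y -> bool) l : int :=
  \sum_(m in nbrs l) \sum_(n in nbrs l) (signed_adj w m n)%:R * apex_weight (c m) (c n).

Lemma apex_sum_le (c : Y -> bool) l :
  4 * apex_sum c l <=
    - (\sum_(x in off l) #|nbrs l :&: blocks_through x| ^ 2)%:R
    + 6 * (energy w (off l) (fun x => [set m in nbrs l | c m] :&: blocks_through x))%:R
    + 6 * (energy w (off l) (fun x => [set m in nbrs l | ~~ c m] :&: blocks_through x))%:R.
Proof.
have -> : apex_sum c l = \sum_(x in off l)
    \sum_(m in nbrs l :&: blocks_through x) \sum_(n in nbrs l :&: blocks_through x)
      (w x m != w x n)%:R * apex_weight (c m) (c n).
  have E (F : Y -> int) x : \sum_(m in nbrs l :&: blocks_through x) F m =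
      \sum_(m in nbrs l) (inc x m)%:R * F m.
    rewrite big_mkcond [RHS]big_mkcond; apply: eq_bigr => m _; rewrite !inE.
    by case: (signed_adj w l m); case: (inc x m); rewrite /= ?mul1r ?mul0r.
  under [RHS]eq_bigr => x _.
    rewrite E; under eq_bigr do rewrite E big_distrr.
    over.
  rewrite exchange_big; apply: eq_bigr => m ml; rewrite exchange_big; apply: eq_bigr => n nl.
  rewrite (signed_adj_in_nbrs ml nl) big_mkcondr big_distrl; apply: eq_bigr => x _ /=.
  by case: (inc x m); case: (inc x n); rewrite ?mul0r ?mul1r ?mulr0.
rewrite /energy !natr_sum !big_distrr -sumrN -!big_split /=; apply: ler_sum => x _.
apply: le_trans (sum_apex_weight _ _ _) _.
have setE (p : pred Y) : [set m in nbrs l :&: blocks_through x | p m] =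
    [set m in nbrs l | p m] :&: blocks_through x.
  by apply/setP => m; rewrite !inE andbAC.
have absz_sq (z : int) : (`|z| ^ 2)%N%:R = z ^+ 2 by rewrite natrX natz abszE real_normK ?num_real.
by rewrite !setE !absz_sq natrX.
Qed.

Hypothesis balanced_w : forall x, w x \in balanced (blocks_through x).
Variable D : nat.
Hypothesis light_w : forall l (A : {set Y}), A \subset meeting l ->
  w \notin heavy D q.+1 (off l) (fun x => A :&: blocks_through x).
Hypothesis D_large : (1000 <= D)%N.
Hypothesis q_large : (4 <= q)%N.

(** Each of the two energies is at most [4 * q ^ 5 / D], so the positive part is at most
    [48 * q ^ 5 / D]. The negative part is at least [q ^ 5 / 16] in size, which wins once
    [D > 768]. *)
Lemma apex_sum_lt0 (c : Y -> bool) l : apex_sum c l < 0.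
Proof.
rewrite -(@pmulr_rlt0 _ 4) //; apply: le_lt_trans (apex_sum_le c l) _.
have light (p : pred Y) : (D * energy w (off l)
    (fun x => [set m in nbrs l | p m] :&: blocks_through x) <= 4 * q ^ 5)%N.
  have pl : [set m in nbrs l | p m] \subset meeting l.
    by apply: subset_trans (nbrs_sub_meeting l); apply/subsetP => m; rewrite inE => /andP[].
  have := light_w pl; rewrite inE -leqNgt => /leq_trans; apply.
  rewrite card_off; apply: (@leq_trans (2 * q.+1 ^ 2 * q ^ 3)).
    by rewrite leq_mul2l leq_subr orbT.
  rewrite (expnD q 2 3) mulnA leq_mul2r; apply/orP; right; nia.
have := light (fun m => ~~ c m); have := light c; have := sum_sq_nbrs l balanced_w.
move: (energy _ _ _) (energy _ _ _) (\sum_(x in _) _)%N => a b s hs ha hb.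
have q5 : (0 < q ^ 5)%N by rewrite expn_gt0 q_gt0.
move: (q ^ 5)%N q5 hs ha hb => r r0 hs ha hb.
have : (D * (6 * a + 6 * b) < D * s)%N by nia.
rewrite ltn_mul2l => /andP[_]; lia.
Qed.

Lemma apex_weight_triangle a b c : ~~ ((a == b) && (a == c)) ->
  apex_weight a b + apex_weight b c + apex_weight a c = 0.
Proof. by case: a; case: b; case: c. Qed.

(** Without a monochromatic triangle, the weight summed over all ordered triples is negative when
    grouped by apex, but zero when averaged over cyclic rotations. Nonemptiness of [Y] makes the
    first inequality strict. *)
Lemma signed_adj_arrows : (0 < #|Y|)%N -> edge2col_mono_triangle (signed_adj w).
Proof.
move=> Y0 col.
pose mono x y z := [&& signed_adj w x y, signed_adj w y z, signed_adj w x z,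
  col [set x; y] == col [set y; z] & col [set x; y] == col [set x; z]].
case: (boolP [exists x, exists y, exists z, mono x y z]).
  case/existsP=> x /existsP[y /existsP[z /and5P[xy yz xz /eqP c1 /eqP c2]]].
  exists x, y, z; split=> //; split=> //.
  move: xy yz xz => /andP[xy _] /andP[yz _] /andP[xz _].
  by rewrite /= !inE negb_or xy xz yz.
rewrite negb_exists => /forallP no_mono.
pose tri x y z := [&& signed_adj w x y, signed_adj w x z & signed_adj w y z].
pose F x y z : int := (tri x y z)%:R * apex_weight (col [set x; y]) (col [set x; z]).
have sumF : \sum_x \sum_y \sum_z F x y z < 0.
  have /card_gt0P[l _] := Y0.
  (* The vertex colouring induced by [col] changes with the apex [x]; this is why lightness is
     required for every block and every subset at once. *)
  have FE x : \sum_y \sum_z F x y z = apex_sum (fun m => col [set x; m]) x.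
    rewrite /apex_sum [RHS]big_mkcond; apply: eq_bigr => y _; rewrite inE.
    rewrite /F /tri; case: (signed_adj w x y) => /=; last by rewrite big1 // => z _; rewrite mul0r.
    rewrite [RHS]big_mkcond; apply: eq_bigr => z _; rewrite inE.
    by case: ifP => //=; rewrite mul0r.
  under eq_bigr do rewrite FE.
  rewrite (bigD1 l) //=; apply: ltr_wnDr (apex_sum_lt0 _ _).
  by apply: sumr_le0 => x _; apply/ltW/apex_sum_lt0.
have F0 x y z : F x y z + F y z x + F z x y = 0.
  have triE1 : tri y z x = tri x y z.
    by rewrite /tri (signed_adj_sym y x) (signed_adj_sym z x);
      case: (signed_adj w x y); case: (signed_adj w x z); case: (signed_adj w y z).
  have triE2 : tri z x y = tri x y z.
    by rewrite /tri (signed_adj_sym z y) (signed_adj_sym z x);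
      case: (signed_adj w x y); case: (signed_adj w x z); case: (signed_adj w y z).
  rewrite /F triE1 triE2 (setUC [set y] [set x]) (setUC [set z] [set x]) (setUC [set z] [set y]).
  rewrite -!mulrDr; case: (boolP (tri x y z)) => [/and3P[xy xz yz]|]; last by rewrite mul0r.
  rewrite mul1r addrAC; have := no_mono x; rewrite negb_exists => /forallP/(_ y).
  rewrite negb_exists => /forallP/(_ z); rewrite /mono xy xz yz /= => nm.
  rewrite -[RHS](@apex_weight_triangle (col [set x; y]) (col [set y; z]) (col [set x; z])) //.
  by move: nm; case: (col [set x; y]); case: (col [set y; z]); case: (col [set x; z]).
have : \sum_x \sum_y \sum_z (F x y z + F y z x + F z x y) = 0.
  by rewrite big1 // => x _; rewrite big1 // => y _; rewrite big1.
under eq_bigr do under eq_bigr do rewrite !big_split.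
under eq_bigr do rewrite !big_split; rewrite !big_split /=.
have -> : \sum_x \sum_y \sum_z F y z x = \sum_x \sum_y \sum_z F x y z.
  rewrite exchange_big /=; by apply: eq_bigr => y _; rewrite exchange_big.
have -> : \sum_x \sum_y \sum_z F z x y = \sum_x \sum_y \sum_z F x y z.
  under eq_bigr do rewrite exchange_big /=; by rewrite exchange_big.
by move: sumF; set s := \sum_x _ => s_lt0 s0; lia.
Qed.
End Unital.

(** The O'Nan configuration: a triangle [a], [b], [c] with sides [l1], [l2], [l3], and a fourth
    block [l4] crossing the sides at [x], [y], [z]. Non-incidences express non-degeneracy instead of
    inequalities between points and blocks. *)
Definition onan_free (X Y : finType) (inc : X -> Y -> bool) : Prop :=
  forall l1 l2 l3 l4 a b c x y z,
    inc a l1 -> inc a l2 -> inc b l2 -> inc b l3 -> inc c l3 -> inc c l1 ->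
    inc x l2 -> inc x l4 -> inc y l3 -> inc y l4 -> inc z l1 -> inc z l4 ->
    ~~ inc a l3 -> ~~ inc c l2 -> ~~ inc a l4 -> ~~ inc b l4 -> ~~ inc c l4 -> False.

Theorem onan_free_unital_arrows (X Y : finType) (inc : X -> Y -> bool) (q D : nat) :
    (forall l, #|points_on inc l| = q.+1) ->
    (forall x y, x != y -> exists l, inc x l && inc y l) ->
    (forall x y l m, x != y -> inc x l -> inc y l -> inc x m -> inc y m -> l = m) ->
    #|X| = (q ^ 3 + 1)%N -> onan_free inc ->
    (1000 <= D)%N -> (D * 2 ^ (6 * D) <= q)%N ->
  exists w : {ffun X -> {ffun Y -> bool}},
    K4free (signed_adj inc w) /\ edge2col_mono_triangle (signed_adj inc w).
Proof.
move=> card_pts join join_uniq cardX no_onan D_large q_large.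
have q1000 : (1000 <= q)%N.
  by apply: leq_trans D_large (leq_trans _ q_large); rewrite leq_pmulr ?expn_gt0.
have q0 : (0 < q)%N by apply: leq_trans q1000.
have card_bl := card_blocks_through card_pts join join_uniq cardX q0.
pose N := (q ^ 3 - q)%N.
pose J := [set i : Y * {set Y} | i.2 \subset meeting inc i.1].
(* The events are indexed by a block and a subset of its meeting blocks. Their number is below
   [2 ^ N * 2 ^ (2 * N)], and the required extra factor [2 ^ (3 * N)] explains the exponent 6. The
   bound [k = q + 1] is the number of meeting blocks through a point off the block. *)
have [|||||||w [bal light]] := @exists_light_signs X Y _ 6 D q.+1 N J
    (fun i => off inc i.1) (fun i x => i.2 :&: blocks_through inc x) (blocks_through inc).
- by [].
- exact: leqW.
- by move=> i _; apply: card_off.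
- move=> [l A] x; rewrite inE /= => Al xl.
  apply: leq_trans (card_meeting_through card_pts join_uniq xl).
  by apply/subset_leq_card/setSI.
- move=> x; rewrite card_bl; nia.
- rewrite cardX /N; nia.
- have le_J : (#|J| <= #|Y| * 2 ^ (2 * N))%N.
    rewrite -sum1_card big_mkcond; under eq_bigr do rewrite inE.
    rewrite -(pair_bigA _ (fun (l : Y) (A : {set Y}) => if A \subset meeting inc l then 1 else 0)%N) /=.
    rewrite -sum_nat_const; apply: leq_sum => l _; rewrite -big_mkcond.
    rewrite (eq_bigl (mem (powerset (meeting inc l)))) => [|A]; last by rewrite /= powersetE.
    rewrite sum1_card card_powerset leq_exp2l //.
    exact: (card_meeting card_pts join_uniq cardX q0).
  (* The chain is [#|Y| <= q ^ 6 < 2 ^ (6 * q) <= 2 ^ N]. *)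
  have lt_Y : (#|Y| < 2 ^ N)%N.
    apply: leq_ltn_trans (card_blocks card_pts join join_uniq cardX q0) _.
    have le_q6 : ((q ^ 3 + 1) * q ^ 2 <= q ^ 6)%N by rewrite (expnD q 4 2) leq_mul2r; nia.
    apply: leq_ltn_trans le_q6 (@leq_trans ((2 ^ q) ^ 6) _ _ _ _).
      by rewrite ltn_exp2r // ltn_expl.
    by rewrite -expnM leq_exp2l // /N; nia.
  apply: leq_ltn_trans (leq_mul le_J (leqnn _)) _.
  by rewrite -mulnA -expnD (_ : 6 * N = N + (2 * N + 3 * N))%N ?expnD ?ltn_pmul2r ?expn_gt0 //; lia.
exists w; split; last first.
  apply: (signed_adj_arrows card_pts join join_uniq cardX q0 bal (D := D)) => //.
  - by move=> l A Al; apply: (light (l, A)); rewrite inE.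
  - exact: leq_trans q1000.
  have /card_gt0P[x _] : (0 < #|X|)%N by rewrite cardX addn1.
  by apply: leq_trans (max_card (mem (blocks_through inc x))); rewrite card_bl expn_gt0 q0.
case=> l1 [l2 [l3 [l4 [_ /and5P[E12 E13 E14 E23 /andP[E24 E34]]]]]].
have [_ [a [a1 a2 _]]] := signed_adjP _ _ _ _ E12.
have [_ [b [b2 b3 _]]] := signed_adjP _ _ _ _ E23.
have [_ [c [c1 c3 _]]] := signed_adjP _ _ _ _ E13.
have [_ [x [x2 x4 _]]] := signed_adjP _ _ _ _ E24.
have [_ [y [y3 y4 _]]] := signed_adjP _ _ _ _ E34.
have [_ [z [z1 z4 _]]] := signed_adjP _ _ _ _ E14.
have nonconc := signed_adj_no_concurrent join_uniq.
(* The six edges of a K4 supply the six intersection points; each non-incidence holds because three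
   of the four blocks would otherwise form a concurrent triangle. *)
apply: (no_onan l1 l2 l3 l4 a b c x y z) => //; apply/negP => h.
- exact: (nonconc _ _ _ _ a E12 E23 E13).
- exact: (nonconc _ _ _ _ c E12 E23 E13).
- exact: (nonconc _ _ _ _ a E12 E24 E14).
- exact: (nonconc _ _ _ _ b E23 E34 E24).
- exact: (nonconc _ _ _ _ c E13 E34 E14).
Qed.

(** * The Hermitian unital *)

Lemma card_roots_lt (F : finFieldType) (p : {poly F}) (A : {set F}) :
  p != 0 -> (forall x, x \in A -> root p x) -> (#|A| < size p)%N.
Proof.
move=> p0 Ap; rewrite cardE; apply: max_poly_roots p0 _ (enum_uniq _).
by apply/allP => x; rewrite mem_enum => /Ap.
Qed.

(** Tight counting turns upper bounds on fibres into equalities. For trace and norm the upper bounds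
    come from polynomial degrees, and surjectivity comes for free. *)
Lemma card_fiber (T S : finType) (A : {set T}) (B : {set S}) (f : T -> S) (a b : nat) :
    (forall x, x \in A -> f x \in B) ->
    (forall y, y \in B -> #|[set x in A | f x == y]| <= a)%N ->
    (#|B| <= b)%N -> #|A| = (a * b)%N ->
  forall y, y \in B -> #|[set x in A | f x == y]| = a.
Proof.
move=> fAB fib Bb Aab y yB; apply/eqP; rewrite eqn_leq fib //= leqNgt; apply/negP => lt_a.
have cardA : #|A| = (\sum_(z in B) #|[set x in A | f x == z]|)%N.
  rewrite -sum1_card (partition_big f (mem B)) //=; apply: eq_bigr => z _.
  by rewrite -sum1_card; apply: eq_bigl => x; rewrite inE.
have : (#|A| < \sum_(z in B) a)%N.
  rewrite cardA (bigD1 y) //= [ltnRHS](bigD1 y) //= -addSn leq_add //.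
  by apply: leq_sum => z /andP[zB _]; apply: fib.
by rewrite sum_nat_const Aab ltnNge mulnC leq_mul2l Bb orbT.
Qed.

(** * Cross products and linear dependence in three-dimensional space *)

Section Vectors.
Variable F : fieldType.
Implicit Types u v a b l p : F * F * F.

Definition vec0 : F * F * F := (0, 0, 0).
Definition dot u v := u.1.1 * v.1.1 + u.1.2 * v.1.2 + u.2 * v.2.
Definition lin s u t v : F * F * F :=
  (s * u.1.1 + t * v.1.1, s * u.1.2 + t * v.1.2, s * u.2 + t * v.2).
Definition scale s u : F * F * F := (s * u.1.1, s * u.1.2, s * u.2).
Definition cross u v : F * F * F :=
  (u.1.2 * v.2 - u.2 * v.1.2, u.2 * v.1.1 - u.1.1 * v.2, u.1.1 * v.1.2 - u.1.2 * v.1.1).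

Lemma triple_eq (x y z x' y' z' : F) : x = x' -> y = y' -> z = z' -> (x, y, z) = (x', y', z').
Proof. by move=> -> -> ->. Qed.

Lemma dotC u v : dot u v = dot v u.
Proof. rewrite /dot; ring. Qed.

Lemma dot_lin l s u t v : dot l (lin s u t v) = s * dot l u + t * dot l v.
Proof. rewrite /dot /lin /=; ring. Qed.

Lemma dot_scale l s u : dot l (scale s u) = s * dot l u.
Proof. rewrite /dot /scale /=; ring. Qed.

Lemma dot_cross_l u v : dot (cross u v) u = 0.
Proof. rewrite /dot /cross /=; ring. Qed.

Lemma dot_cross_r u v : dot (cross u v) v = 0.
Proof. rewrite /dot /cross /=; ring. Qed.

Lemma scaleA s t u : scale s (scale t u) = scale (s * t) u.
Proof. by rewrite /scale /= !mulrA. Qed.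

Lemma scale1 u : scale 1 u = u.
Proof. by case: u => [[x y] z]; rewrite /scale /= !mul1r. Qed.

Lemma scale0 u : scale 0 u = vec0.
Proof. by rewrite /scale !mul0r. Qed.

Lemma nonzero_coord u : u != vec0 -> [\/ u.1.1 != 0, u.1.2 != 0 | u.2 != 0].
Proof.
case: u => [[x y] z] /=; rewrite -!pair_eqE /= -pair_eqE /=.
case: eqP => [_|]; last by constructor 1.
by case: eqP => [_|]; [constructor 3|constructor 2].
Qed.

Lemma cross0_scale u n : n != vec0 -> cross u n = vec0 -> exists s, u = scale s n.
Proof.
case: u n => [[x y] z] [[a b] c] /nonzero_coord /= n0 [/subr0_eq e1 /subr0_eq e2 /subr0_eq e3].
case: n0 => n0; [exists (x / a)|exists (y / b)|exists (z / c)]; apply: triple_eq;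
  rewrite /= ?mulfVK // mulrAC.
- by rewrite e3 mulfK.
- by rewrite -e2 mulfK.
- by rewrite -e3 mulfK.
- by rewrite e1 mulfK.
- by rewrite e2 mulfK.
- by rewrite -e1 mulfK.
Qed.

Lemma cross_lin_l s u t v : cross (lin s u t v) v = scale s (cross u v).
Proof. rewrite /cross /lin /scale /=; apply: triple_eq; ring. Qed.

Lemma cross_lin_r s u t v : cross u (lin s u t v) = scale t (cross u v).
Proof. rewrite /cross /lin /scale /=; apply: triple_eq; ring. Qed.

Lemma scale_eq0 s u : u != vec0 -> scale s u = vec0 -> s = 0.
Proof.
move=> /nonzero_coord u0 [/eqP e1 /eqP e2 /eqP e3]; apply/eqP.
by move: e1 e2 e3; rewrite !mulf_eq0; case: u0 => /negPf ->; rewrite orbF.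
Qed.

Lemma lin_indep s u t v : cross u v != vec0 -> lin s u t v = vec0 -> s = 0 /\ t = 0.
Proof.
move=> uv e; split; apply: (scale_eq0 uv).
  by rewrite -(cross_lin_l s u t v) e /cross /= !mul0r subr0.
by rewrite -(cross_lin_r s u t v) e /cross /= !mulr0 subr0.
Qed.

Lemma perp_cross l u v : cross u v != vec0 -> dot l u = 0 -> dot l v = 0 ->
  exists s, l = scale s (cross u v).
Proof.
move=> uv lu lv; apply: cross0_scale => //.
(* The vector triple product formula. *)
have -> : cross l (cross u v) = lin (dot l v) u (- dot l u) v.
  rewrite /cross /lin /dot /=; apply: triple_eq; ring.
by rewrite lu lv /lin oppr0 !mul0r addr0.
Qed.

Lemma perp_lin p u v : cross u v != vec0 -> dot (cross u v) p = 0 ->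
  exists s t, p = lin s u t v.
Proof.
move=> /nonzero_coord n0 np; have [w nw] : exists w, dot (cross u v) w != 0.
  by case: n0 => n0; [exists (1, 0, 0)|exists (0, 1, 0)|exists (0, 0, 1)];
    rewrite /dot /= !mulr0 mulr1 ?addr0 ?add0r.
(* Cramer's rule for [p] in the basis [u], [v], [w]; the coefficient of [w] vanishes by
   hypothesis. *)
have E : scale (dot (cross u v) w) p =
    lin 1 (lin (dot (cross p v) w) u (dot (cross u p) w) v) (dot (cross u v) p) w.
  rewrite /scale /lin /dot /cross /=; apply: triple_eq; ring.
exists ((dot (cross u v) w)^-1 * dot (cross p v) w), ((dot (cross u v) w)^-1 * dot (cross u p) w).
rewrite -[LHS]scale1 -(mulVf nw) -scaleA E np /scale /lin /=.
apply: triple_eq; ring.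
Qed.
End Vectors.

(** * The projective plane, the Hermitian form and the points of the unital *)

Section Hermitian.
Variables (F : finFieldType) (q : nat) (bar : {rmorphism F -> F}).
Implicit Types u v a b l m p : F * F * F.

Definition nrm u : F * F * F :=
  scale (if u.1.1 != 0 then u.1.1^-1 else if u.1.2 != 0 then u.1.2^-1 else u.2^-1) u.

Lemma nrmP u : u != vec0 F -> normalized (nrm u) /\ exists2 s, s != 0 & nrm u = scale s u.
Proof.
move=> /nonzero_coord u0; split; last first.
  rewrite /nrm; case: ifP => [x0|/negbFE x0]; first by eexists; [|reflexivity]; rewrite invr_eq0.
  case: ifP => [y0|/negbFE y0]; first by eexists; [|reflexivity]; rewrite invr_eq0.
  by eexists; [|reflexivity]; rewrite invr_eq0; move: u0; rewrite x0 y0 => -[].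
rewrite /normalized /nrm /scale /=; case: ifP => [x0|/negbFE/eqP x0]; first by rewrite mulVf ?eqxx.
rewrite x0 mulr0 eqxx; case: ifP => [y0|/negbFE/eqP y0]; first by rewrite mulVf ?eqxx ?orbT.
by rewrite y0 mulr0 eqxx mulVf ?eqxx ?orbT //; move: u0; rewrite x0 y0 eqxx => -[].
Qed.

Lemma normalized_neq0 u : normalized u -> u != vec0 F.
Proof.
rewrite /normalized; apply: contraTneq => -> /=.
by rewrite eqxx eq_sym oner_eq0.
Qed.

Lemma normalized_scale u v s : normalized u -> normalized v -> v = scale s u -> v = u.
Proof.
move=> nu nv; have := normalized_neq0 nv.
case: u v nu nv => [[x y] z] [[x' y'] z']; rewrite /normalized /scale /= => nu nv v0 [ex ey ez].
have s0 : s != 0 by apply: contra_neq v0 => s0; rewrite ex ey ez s0 !mul0r.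
have s1 : s = 1; last by rewrite ex ey ez s1 !mul1r.
move: nu nv; rewrite ex ey ez !mulf_eq0 (negPf s0) /=.
case/or3P => [/eqP ->|/andP[/eqP -> /eqP ->]|/and3P[/eqP -> /eqP -> /eqP ->]];
  by rewrite ?mulr1 ?mulr0 ?eqxx ?oner_eq0 ?(eq_sym 0) ?oner_eq0 /= ?orbF => /eqP.
Qed.

Lemma cross_neq0 a b : normalized a -> normalized b -> a != b -> cross a b != vec0 F.
Proof.
move=> na nb; apply: contra_neq => ab.
have [s] := cross0_scale (normalized_neq0 nb) ab; exact: normalized_scale.
Qed.

Lemma incidentE l p : incident l p = (dot l p == 0).
Proof. by []. Qed.

Lemma line_unique l m a b : normalized l -> normalized m -> normalized a -> normalized b ->
  a != b -> incident l a -> incident l b -> incident m a -> incident m b -> l = m.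
Proof.
rewrite !incidentE => nl nm na nb ab /eqP la /eqP lb /eqP ma /eqP mb.
have n0 := cross_neq0 na nb ab.
have [s ls] := perp_cross n0 la lb; have [t mt] := perp_cross n0 ma mb.
have t0 : t != 0.
  by apply: contra_neq (normalized_neq0 nm) => t0; rewrite mt t0 scale0.
apply: (normalized_scale (s := s / t)) => //.
by rewrite mt scaleA divfK.
Qed.

Lemma line_through a b : normalized a -> normalized b -> a != b ->
  exists l, [&& normalized l, incident l a & incident l b].
Proof.
move=> na nb ab; have [nl [s _ ls]] := nrmP (cross_neq0 na nb ab).
exists (nrm (cross a b)); rewrite nl !incidentE ls dotC dot_scale dotC dot_cross_l mulr0 eqxx.
by rewrite dotC dot_scale dotC dot_cross_r mulr0 eqxx.
Qed.

Hypothesis q_gt1 : (1 < q)%N.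
Hypothesis barE : forall x, bar x = x ^+ q.
Hypothesis cardF : #|F| = (q ^ 2)%N.

Lemma barK x : bar (bar x) = x.
Proof. by rewrite !barE -exprM mulnn -cardF expf_card. Qed.

Lemma bar_eq0 x : (bar x == 0) = (x == 0).
Proof. by rewrite fmorph_eq0. Qed.

Definition conj_vec u : F * F * F := (bar u.1.1, bar u.1.2, bar u.2).
Definition herm u v := dot u (conj_vec v).

Lemma unitalE p : unital q p = (herm p p == 0).
Proof. by rewrite /unital /herm /dot /= !exprS !barE. Qed.

Lemma bar_herm u v : bar (herm u v) = herm v u.
Proof. by rewrite /herm /dot /= !rmorphD !rmorphM !barK /=; ring. Qed.

Lemma herm_lin s u t v : herm (lin s u t v) (lin s u t v) =
  s * bar s * herm u u + t * bar t * herm v v + s * bar t * herm u v + t * bar s * herm v u.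
Proof. by rewrite /herm /lin /dot /= !rmorphD !rmorphM /=; ring. Qed.

Lemma herm_scale s u : herm (scale s u) (scale s u) = s * bar s * herm u u.
Proof. by rewrite /herm /scale /dot /= !rmorphM /=; ring. Qed.

Lemma cross_conj u v : cross (conj_vec u) (conj_vec v) = conj_vec (cross u v).
Proof. by rewrite /cross /conj_vec /= !rmorphB !rmorphM. Qed.

Lemma dot_conj u v : dot (conj_vec u) (conj_vec v) = bar (dot u v).
Proof. by rewrite /dot !rmorphD !rmorphM. Qed.

Lemma conj_vec_eq0 u : conj_vec u = vec0 F -> u = vec0 F.
Proof.
by case: u => [[x y] z] [/eqP + /eqP + /eqP]; rewrite !bar_eq0 => /eqP -> /eqP -> /eqP ->.
Qed.

(* Otherwise the conjugates of a and b would both be multiples of cross a b. *)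
Lemma herm_isotropic_neq0 a b : cross a b != vec0 F -> herm a a = 0 -> herm b b = 0 ->
  herm a b != 0.
Proof.
move=> ab aa bb; apply: contra_neq ab => hab.
have hba : herm b a = 0 by rewrite -bar_herm hab rmorph0.
apply/eqP; apply/negPn/negP => ab.
have [s sb] : exists s, conj_vec b = scale s (cross a b).
  by apply: perp_cross => //; rewrite dotC.
have [t ta] : exists t, conj_vec a = scale t (cross a b).
  by apply: perp_cross => //; rewrite dotC.
case/eqP: ab; apply: conj_vec_eq0; rewrite -cross_conj sb ta /cross /scale /vec0 /=.
by apply: triple_eq; ring.
Qed.

(** The trace maps the [q ^ 2] field elements to the elements fixed by [bar], of which there are at
    most [q], with fibres of size at most [q]. *)
Lemma card_trace0 : #|[set x : F | bar x + x == 0]| = q.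
Proof.
pose B := [set y : F | bar y == y].
have := @card_fiber F F setT B (fun x => bar x + x) q q _ _ _ _ 0.
rewrite inE rmorph0 eqxx => H; rewrite -[RHS]H //.
- by apply: eq_card => x; rewrite !inE.
- by move=> x _; rewrite inE rmorphD barK addrC.
- move=> y _; have sz : size ('X^q + ('X - y%:P)) = q.+1.
    by rewrite size_polyDl size_polyXn // size_XsubC ltnS.
  rewrite -ltnS -sz; apply: card_roots_lt; first by rewrite -size_poly_gt0 sz.
  by move=> x; rewrite !inE /= barE => /eqP xy; rewrite /root hornerD hornerXn hornerXsubC addrA xy subrr.
- have sz : size ('X^q - 'X : {poly F}) = q.+1.
    by rewrite size_polyDl size_polyXn // size_polyN size_polyX ltnS.
  rewrite -ltnS -sz; apply: card_roots_lt; first by rewrite -size_poly_gt0 sz.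
  by move=> x; rewrite inE barE => /eqP xy; rewrite /root !hornerE xy subrr.
- by rewrite cardsT cardF mulnn.
Qed.

(** The norm maps the [q ^ 2 - 1] nonzero elements to the nonzero fixed elements, at most [q - 1] in
    number, with fibres of size at most [q + 1]. *)
Lemma card_norm c : bar c = c -> c != 0 -> #|[set x : F | x * bar x == c]| = q.+1.
Proof.
move=> cc c0; pose B := [set y : F | (y != 0) && (bar y == y)].
have := @card_fiber F F [set~ 0] B (fun x => x * bar x) q.+1 q.-1 _ _ _ _ c.
rewrite inE c0 cc eqxx => H; rewrite -[RHS]H //.
- apply: eq_card => x; rewrite !inE; case: (eqVneq x 0) => [->|//].
  by rewrite mul0r eq_sym (negPf c0).
- by move=> x; rewrite !inE => x0; rewrite mulf_neq0 ?bar_eq0 //= rmorphM barK mulrC.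
- move=> y _; have sz := size_XnsubC y (ltn0Sn q).
  rewrite -ltnS -sz; apply: card_roots_lt; first by rewrite -size_poly_gt0 sz.
  by move=> x; rewrite !inE /= barE -exprS => /andP[_ /eqP xy]; rewrite /root !hornerE xy subrr.
- have q1 : (0 < q.-1)%N by case: q q_gt1 => [|[]].
  have sz := size_XnsubC (1 : F) q1.
  rewrite -ltnS -sz; apply: card_roots_lt; first by rewrite -size_poly_gt0 sz.
  move=> x; rewrite !inE barE => /andP[x0 /eqP xy]; rewrite /root !hornerE.
  by rewrite subr_eq0 -(inj_eq (mulfI x0)) -exprS prednK ?(ltnW q_gt1) // xy mulr1.
- rewrite cardsC1 cardF; nia.
Qed.

(** Points are split by normal form: [(1, y, z)], [(0, 1, z)], while [(0, 0, 1)] is not isotropic.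
    For the first form, [z] has [q + 1] values unless [y] has norm -1; then only [z = 0] remains. *)
Lemma card_unital : #|[set p : F * F * F | normalized p && unital q p]| = (q ^ 3 + 1)%N.
Proof.
have norm_bar (x : F) : bar (x * bar x) = x * bar x by rewrite rmorphM barK mulrC.
pose S1 := [set u : F * F | 1 + u.1 * bar u.1 + u.2 * bar u.2 == 0].
pose S2 := [set z : F | z * bar z == -1].
pose f1 (u : F * F) : F * F * F := (1, u.1, u.2).
pose f2 (z : F) : F * F * F := (0, 1, z).
have -> : [set p : F * F * F | normalized p && unital q p] = f1 @: S1 :|: f2 @: S2.
  apply/setP => -[[x y] z]; rewrite !inE unitalE /normalized /herm /dot /=.
  apply/andP/orP => [[/or3P[/eqP ->|/andP[/eqP -> /eqP ->]|/and3P[/eqP -> /eqP -> /eqP ->]]]|].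
  - by rewrite rmorph1 mulr1 => e; left; apply/imsetP; exists (y, z); rewrite ?inE.
  - rewrite rmorph1 rmorph0 mulr1 mulr0 add0r addrC addr_eq0 => e; right.
    by apply/imsetP; exists z; rewrite ?inE.
  - by rewrite rmorph1 rmorph0 mulr1 mulr0 !add0r oner_eq0.
  - case=> /imsetP[]; first by case=> y' z'; rewrite inE /= => e [-> -> ->];
      rewrite rmorph1 mulr1 eqxx.
    move=> z'; rewrite inE => /eqP e [-> -> ->].
    by rewrite rmorph1 rmorph0 mulr1 mulr0 add0r e subrr !eqxx orbT.
have cS2 : #|S2| = q.+1 by apply: card_norm; rewrite ?rmorphN1 // oppr_eq0 oner_eq0.
have cS1 : #|S1| = ((q ^ 2 - q.+1) * q.+1 + q.+1)%N.
  transitivity (\sum_(y : F) #|[set z : F | z * bar z == - (1 + y * bar y)]%R|)%N.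
    rewrite -sum1_card big_mkcond; under eq_bigr do rewrite inE.
    rewrite -(pair_bigA _ (fun y z : F => if 1 + y * bar y + z * bar z == 0 then 1%N else 0%N)) /=.
    apply: eq_bigr => y _; rewrite -big_mkcond sum1dep_card; apply: eq_card => z.
    by rewrite !inE addrC addr_eq0.
  rewrite (bigID (mem S2)) /= addnC; congr (_ + _)%N.
    rewrite (eq_bigr (fun=> q.+1)) => [|y]; last first.
      rewrite inE => yS; apply: card_norm; first by rewrite rmorphN rmorphD rmorph1 norm_bar.
      by rewrite oppr_eq0 addrC addr_eq0.
    rewrite sum_nat_const -cS2 -cardF; congr (_ * _)%N.
    by rewrite -(cardC (mem S2)) addKn; apply: eq_card => y; rewrite !inE.
  rewrite (eq_bigr (fun=> 1%N)) ?sum1_card // => y; rewrite inE => /eqP ->.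
  rewrite subrr oppr0 -(cards1 (0 : F)); apply: eq_card => z.
  by rewrite !inE mulf_eq0 bar_eq0 orbb.
rewrite cardsU disjoint_setI0 ?cards0 ?subn0; last first.
  apply/pred0Pn => -[p /andP[/imsetP[u _ ->] /imsetP[z _ [/eqP]]]].
  by rewrite oner_eq0.
rewrite !card_imset ?cS1 ?cS2; [nia|by move=> z z' []|by move=> [y z] [y' z'] [-> ->]].
Qed.

(** Besides [a], the points of [l] are represented by [x a + b]. As [a] and [b] are isotropic, the
    form there is the trace of [x * herm a b], which vanishes for exactly [q] values of [x]. *)
Lemma card_secant l a b : normalized l -> normalized a -> normalized b -> a != b ->
    incident l a -> incident l b -> unital q a -> unital q b ->
  #|[set p | [&& normalized p, incident l p & unital q p]]| = q.+1.
Proof.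
rewrite !incidentE !unitalE => nl na nb ab /eqP la /eqP lb /eqP aa /eqP bb.
have n0 := cross_neq0 na nb ab.
have hab := herm_isotropic_neq0 n0 aa bb.
pose W := [set x : F | bar (x * herm a b) + x * herm a b == 0].
have cW : #|W| = q.
  rewrite -card_trace0 -(card_imset (mem W) (mulIf hab)); apply: eq_card => y.
  rewrite !inE; apply/imsetP/idP => [[x + ->]|yT]; first by rewrite !inE.
  by exists (y / herm a b); rewrite ?inE divfK.
pose f x := nrm (lin x a 1 b).
have lin0 x : lin x a 1 b != vec0 F.
  by apply/eqP => /(lin_indep n0)[_ /eqP]; rewrite oner_eq0.
have fP x : normalized (f x) /\ exists2 s, s != 0 & f x = scale s (lin x a 1 b).
  exact: nrmP.
have hermW x : herm (lin x a 1 b) (lin x a 1 b) = bar (x * herm a b) + x * herm a b.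
  by rewrite herm_lin aa bb rmorph1 rmorphM bar_herm; ring.
have -> : [set p | [&& normalized p, incident l p & unital q p]] = a |: f @: W.
  apply/setP => p; rewrite !inE incidentE unitalE; apply/and3P/orP.
    case=> np /eqP lp /eqP pp.
    have [c lc] := perp_cross n0 la lb.
    have c0 : c != 0 by apply: contra_neq (normalized_neq0 nl) => c0; rewrite lc c0 scale0.
    have [s [t pE]] : exists s t, p = lin s a t b.
      apply: perp_lin n0 _; move: lp; rewrite lc dotC dot_scale dotC => /eqP.
      by rewrite mulf_eq0 (negPf c0) => /eqP.
    have [t0|t0] := eqVneq t 0.
      left; apply/eqP/(normalized_scale (s := s) na np).
      by rewrite pE t0 /lin /scale !mul0r !addr0.
    have pE' : p = scale t (lin (s / t) a 1 b).
      by rewrite pE /lin /scale /=; apply: triple_eq; field.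
    right; apply/imsetP; exists (s / t).
      rewrite inE -hermW; move/eqP: pp; rewrite pE' herm_scale !mulf_eq0 bar_eq0 (negPf t0) /=.
      by [].
    have [nf [c' c'0 fE]] := fP (s / t).
    apply: (normalized_scale (s := t / c')) => //.
    by rewrite fE scaleA divfK.
  case=> [/eqP ->|/imsetP[x]]; first by rewrite na la aa eqxx.
  rewrite inE -hermW => /eqP xx ->; have [nf [c c0 fE]] := fP x.
  by rewrite nf fE herm_scale xx dot_scale dot_lin la lb !mulr0 addr0 mulr0 eqxx.
rewrite cardsU1 card_in_imset ?cW; last first.
  move=> x y _ _ xy; have [_ [c c0 fx]] := fP x; have [_ [d d0 fy]] := fP y.
  have /(lin_indep n0)[e1 /eqP] : lin (c * x - d * y) a (c - d) b = vec0 F.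
    have -> : lin (c * x - d * y) a (c - d) b =
        lin 1 (scale c (lin x a 1 b)) (-1) (scale d (lin y a 1 b)).
      by rewrite /lin /scale /=; apply: triple_eq; ring.
    by rewrite -fx -fy xy /lin; apply: triple_eq; ring.
  rewrite subr_eq0 => /eqP cd; move: e1; rewrite cd -mulrBr => /eqP.
  by rewrite mulf_eq0 (negPf d0) subr_eq0 => /eqP.
case: imsetP => [[x _ aE]|//]; have [_ [c c0 fx]] := fP x.
have /(lin_indep n0)[_ /eqP] : lin (c * x - 1) a c b = vec0 F.
  have -> : lin (c * x - 1) a c b = lin 1 (scale c (lin x a 1 b)) (-1) a.
    by rewrite /lin /scale /=; apply: triple_eq; ring.
  by rewrite -fx -/(f x) -aE /lin; apply: triple_eq; ring.
by rewrite (negPf c0).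
Qed.

(** Multiplicativity of the determinant, with the product written as a Gram matrix. *)
Lemma gram3 a b c a' b' c' : dot (cross a b) c * dot (cross a' b') c' =
  dot a a' * (dot b b' * dot c c' - dot b c' * dot c b')
  - dot a b' * (dot b a' * dot c c' - dot b c' * dot c a')
  + dot a c' * (dot b a' * dot c b' - dot b b' * dot c a').
Proof. by rewrite /dot /cross /=; ring. Qed.

(** The point of [l] on [m] is proportional to [(m.b) a - (m.a) b]. Its isotropy says that the
    displayed product has trace zero. *)
Lemma onan_side l m a b x : normalized l -> cross a b != vec0 F -> normalized x ->
    dot l a = 0 -> dot l b = 0 -> dot l x = 0 -> dot m x = 0 ->
    herm a a = 0 -> herm b b = 0 -> herm x x = 0 -> dot m a != 0 ->
  bar (dot m b * bar (dot m a) * herm a b) = - (dot m b * bar (dot m a) * herm a b).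
Proof.
move=> nl n0 nx la lb lx mx aa bb xx A0.
have [c lc] := perp_cross n0 la lb.
have c0 : c != 0 by apply: contra_neq (normalized_neq0 nl) => c0; rewrite lc c0 scale0.
have [s [t xE]] : exists s t, x = lin s a t b.
  apply: perp_lin n0 _; move/eqP: lx.
  by rewrite lc dotC dot_scale dotC mulf_eq0 (negPf c0) => /eqP.
move: (mx); rewrite xE dot_lin => /eqP; rewrite addr_eq0 => /eqP sA.
have AxE : scale (dot m a) x = scale (- t) (lin (dot m b) a (- dot m a) b).
  by rewrite xE /scale /lin /=; apply: triple_eq; rewrite mulrDr mulrA (mulrC (dot m a)) sA; ring.
have t0 : t != 0.
  apply: contra_neq (normalized_neq0 nx) => t0; apply/eqP/negPn/negP => x0.
  by case/eqP: A0; apply: scale_eq0 x0 _; rewrite AxE t0 oppr0 scale0.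
have := herm_scale (dot m a) x; rewrite xx mulr0 AxE herm_scale => /eqP.
rewrite !mulf_eq0 bar_eq0 oppr_eq0 (negPf t0) /= herm_lin aa bb => /eqP e.
apply/eqP; rewrite -addr_eq0 !rmorphM barK bar_herm; apply/eqP.
by rewrite -[RHS]oppr0 -[in RHS]e !rmorphN; ring.
Qed.

(** A Menelaus-type product: multiplying the three side relations and dividing by norms shows that
    [herm a b * herm b c * herm c a] has trace zero. This trace is the Gram determinant of three
    isotropic vectors, that is, the norm of [dot (cross a b) c], which is nonzero for a genuine
    triangle. *)
Lemma no_onan l1 l2 l3 l4 a b c x y z :
    normalized l1 -> normalized l2 -> normalized l3 ->
    normalized a -> normalized b -> normalized c ->
    normalized x -> normalized y -> normalized z ->
    unital q a -> unital q b -> unital q c -> unital q x -> unital q y -> unital q z ->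
    incident l1 a -> incident l2 a -> incident l2 b -> incident l3 b ->
    incident l3 c -> incident l1 c ->
    incident l2 x -> incident l4 x -> incident l3 y -> incident l4 y ->
    incident l1 z -> incident l4 z ->
    ~~ incident l3 a -> ~~ incident l2 c ->
    ~~ incident l4 a -> ~~ incident l4 b -> ~~ incident l4 c -> False.
Proof.
rewrite !unitalE !incidentE => n1 n2 n3 na nb nc nx ny nz /eqP aa /eqP bb /eqP cc.
move=> /eqP xx /eqP yy /eqP zz /eqP a1 /eqP a2 /eqP b2 /eqP b3 /eqP c3 /eqP c1.
move=> /eqP x2 /eqP x4 /eqP y3 /eqP y4 /eqP z1 /eqP z4 a3 c2 a4 b4 c4.
have ab : cross a b != vec0 F by apply: cross_neq0 => //; apply: contraNneq a3 => ->; apply/eqP.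
have bc : cross b c != vec0 F by apply: cross_neq0 => //; apply: contraNneq c2 => <-; apply/eqP.
have ca : cross c a != vec0 F by apply: cross_neq0 => //; apply: contraNneq c2 => ->; apply/eqP.
have e1 := onan_side n2 ab nx a2 b2 x2 x4 aa bb xx a4.
have e2 := onan_side n3 bc ny b3 c3 y3 y4 bb cc yy b4.
have e3 := onan_side n1 ca nz c1 a1 z1 z4 cc aa zz c4.
have det0 : dot (cross a b) c != 0.
  have [s ls] := perp_cross ab a2 b2; apply: contraNneq c2 => det0.
  by rewrite ls dotC dot_scale dotC det0 mulr0.
have := gram3 a b c (conj_vec a) (conj_vec b) (conj_vec c); rewrite -!/(herm _ _) aa bb cc.
have -> : herm (cross (conj_vec a) (conj_vec b)) c = bar (dot (cross a b) c).
  by rewrite /herm cross_conj dot_conj.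
move=> gram; have : dot (cross a b) c * bar (dot (cross a b) c) != 0.
  by rewrite mulf_neq0 ?bar_eq0.
rewrite gram; case/eqP.
set A := dot l4 a in e1 e3 a4 *; set B := dot l4 b in e1 e2 b4 *; set C := dot l4 c in e2 e3 c4 *.
have M0 : A * bar A * (B * bar B) * (C * bar C) != 0 by rewrite !mulf_neq0 ?bar_eq0.
apply: (mulfI M0); rewrite [RHS]mulr0.
(* A product of three elements that [bar] negates is again negated; the factors of [l4] pair up into
   norms. *)
have : bar (B * bar A * herm a b * (C * bar B * herm b c) * (A * bar C * herm c a)) =
    - (B * bar A * herm a b * (C * bar B * herm b c) * (A * bar C * herm c a)).
  by rewrite rmorphM rmorphM e1 e2 e3; ring.
rewrite !rmorphM !barK !bar_herm => /eqP; rewrite -addr_eq0 => /eqP e.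
by rewrite -[RHS]e; ring.
Qed.
End Hermitian.

(** * Conjugation as an iterated Frobenius map, and transfer of the result to the graph of
    secants *)

Lemma frobenius_rmorphism (F : finFieldType) (q : nat) :
  prime_power q -> #|F| = (q ^ 2)%N ->
  exists bar : {rmorphism F -> F}, forall x, bar x = x ^+ q.
Proof.
case=> p [k [p_pr _ ->]]; rewrite -expnM => cardF.
have charF := card_finPcharP cardF p_pr.
elim: k {cardF} => [|k [bar barE]]; first by exists idfun => x; rewrite expr1.
exists (pFrobenius_aut charF \o bar) => x /=.
by rewrite pFrobenius_autE barE -exprM expnSr.
Qed.

Lemma hermitian_arrows (q D : nat) (F : finFieldType) :
    prime_power q -> (1000 <= D)%N -> (D * 2 ^ (6 * D) <= q)%N -> #|F| = (q ^ 2)%N ->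
  exists E' : rel (F * F * F),
    [/\ symmetric E', subrel E' (@Hadj F q), K4free E' & edge2col_mono_triangle E'].
Proof.
move=> q_pp D_large q_large cardF; have [bar barE] := frobenius_rmorphism q_pp cardF.
have q1 : (1 < q)%N.
  apply: (@leq_trans 1000) => //; apply: leq_trans D_large (leq_trans _ q_large).
  by rewrite leq_pmulr ?expn_gt0.
pose X := {p : F * F * F | normalized p && unital q p}.
pose Y := {l : F * F * F | secant q l}.
pose inc (x : X) (l : Y) := incident (val l) (val x).
have normY (l : Y) : normalized (val l) by have /andP[] := valP l.
have [nX uX] : (forall x : X, normalized (val x)) /\ (forall x : X, unital q (val x)).
  by split=> x; have /andP[] := valP x.
have cardpts (l : Y) : #|points_on inc l| = q.+1.
  have /andP[_ /eqP <-] := valP l; rewrite -(card_imset _ val_inj); apply: eq_card => p.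
  rewrite inE; apply/imsetP/and3P => [[x + ->]|[np lp up]].
    by rewrite inE; split; rewrite ?nX ?uX.
  have Xp : normalized p && unital q p by rewrite np up.
  by exists (Sub p Xp); rewrite ?inE /inc SubK.
have joined (x y : X) : x != y -> exists l, inc x l && inc y l.
  move=> xy; have [l /and3P[nl lx ly]] := line_through (nX x) (nX y) xy.
  have sl : secant q l.
    by rewrite /secant nl (card_secant q1 barE cardF nl (nX x) (nX y) xy lx ly) ?uX /=.
  by exists (Sub l sl); rewrite /inc SubK lx ly.
have joined_uniq (x y : X) (l m : Y) :
    x != y -> inc x l -> inc y l -> inc x m -> inc y m -> l = m.
  by move=> xy xl yl xm ym; apply/val_inj/(line_unique _ _ (nX x) (nX y)).
have cardX : #|{: X}| = (q ^ 3 + 1)%N.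
  by rewrite card_sig -(card_unital q1 barE cardF) cardsE; apply: eq_card.
have onan : onan_free inc.
  move=> l1 l2 l3 l4 a b c x y z.
  by apply: (no_onan barE cardF) => //; apply: normY.
have [w [K4w arrw]] :=
  onan_free_unital_arrows cardpts joined joined_uniq cardX onan D_large q_large.
(* The graph on the subtype of secants is extended to all triples, with triples that are not secants
   left isolated. *)
pose E' : rel (F * F * F) := fun u v =>
  if (insub u : option Y) is Some l then
    if (insub v : option Y) is Some m then signed_adj inc w l m else false
  else false.
have E'P u v : E' u v -> exists l m : Y, [/\ u = val l, v = val m & signed_adj inc w l m].
  rewrite /E'; case: insubP => // l _ <-; case: insubP => // m _ <- lm.
  by exists l, m.
have E'val (l m : Y) : E' (val l) (val m) = signed_adj inc w l m by rewrite /E' !valK.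
exists E'; split.
- have E'sym u v : E' u v -> E' v u.
    by move=> /E'P[l [m [-> -> lm]]]; rewrite E'val signed_adj_sym.
  by move=> u v; apply/idP/idP; apply: E'sym.
- move=> u v /E'P[l [m [-> -> /signed_adjP[lm [x [xl xm _]]]]]].
  rewrite /Hadj (valP l) (valP m) (inj_eq val_inj) lm /=; apply/existsP; exists (val x).
  apply/and4P; split=> //.
- case=> a [b [c [d [un /and5P[ab ac ad bc /andP[bd cd]]]]]]; apply: K4w.
  have [la [lb [ea eb _]]] := E'P _ _ ab; have [lc [ld [ec ed _]]] := E'P _ _ cd.
  subst; exists la, lb, lc, ld; split; last by rewrite -!E'val ab ac ad bc bd cd.
  by rewrite -(map_inj_uniq (@val_inj _ _ Y)).
(* A colouring of pairs of triples is pulled back to pairs of secants by taking images under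
   [val]. *)
- move=> col; have [x [y [z [[un xy yz xz] [c1 c2]]]]] := arrw (fun A => col (val @: A)).
  exists (val x), (val y), (val z); split; last by rewrite -!imset_set1 -!imsetU.
  by rewrite !E'val xy yz xz; split=> //; move: un; rewrite -(map_inj_uniq (@val_inj _ _ Y)).
Qed.

Theorem theorem2 :
  exists q0 : nat, prime_power q0 /\
    forall (q : nat) (F : finFieldType),
      prime_power q -> (q0 <= q)%N -> #|F| = (q ^ 2)%N ->
      exists E' : rel (F * F * F),
        [/\ symmetric E',
            subrel E' (@Hadj F q),
            K4free E'
          & edge2col_mono_triangle E'].
Proof.
(* Taking [D = 2 ^ k] makes the threshold [D * 2 ^ (6 * D)] itself a prime power. The existential
   hides the value of [k], so that the huge numeral is never computed. *)
have [k le_k] : exists k, (1000 <= 2 ^ k)%N by exists 10.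
exists (2 ^ (k + 6 * 2 ^ k))%N; split.
  by exists 2, (k + 6 * 2 ^ k)%N; rewrite addn_gt0 muln_gt0 expn_gt0 orbT.
move=> q F q_pp q_large; apply: (hermitian_arrows q_pp le_k).
by rewrite -expnD.
Qed.
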